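(* If $c\in\mathbb{R}^m$ generates an extreme ray of $C_{\mathrm{SAGE}}(A)$, then the set $\{a_i: i\in[m],\ c_i\ne 0\}$ is either a singleton or a simplicial circuit.
   Context: Let $A\in\mathbb{R}^{n\times m}$ have distinct columns $a_1,\dots,a_m$. For $c\in\mathbb{R}^m$, $\mathrm{Sig}(A,c)$ denotes the function $x\mapsto\sum_{i=1}^m c_i\exp(a_i^\top x)$ on $\mathbb{R}^n$. $C_{\mathrm{NNS}}(A)=\{c\in\mathbb{R}^m:\mathrm{Sig}(A,c)(x)\ge 0\ \forall x\in\mathbb{R}^n\}$. For $k\in[m]$, the $k$-th AGE cone is $C_{\mathrm{AGE}}(A,k)=\{c\in C_{\mathrm{NNS}}(A): c_i\ge 0\ \forall i\ne k\}$, and the SAGE cone is the Minkowski sum $C_{\mathrm{SAGE}}(A)=\sum_{k=1}^m C_{\mathrm{AGE}}(A,k)$. A finite point set $\{x_1,\dots,x_\ell\}$ is a circuit if it is affinely dependent but every proper subset is affinely independent; a circuit with $\ell$ elements is simplicial if its convex hull has exactly $\ell-1$ extreme points. *)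

(* Defs.v *)
From mathcomp Require Import all_boot.
From Stdlib Require Import Reals List.
Set Implicit Arguments. Unset Strict Implicit. Unset Printing Implicit Defensive.
Local Open Scope R_scope.

Definition point (n : nat) := 'I_n -> R.

Definition dotR (n : nat) (a x : point n) : R :=
  \big[Rplus/0]_(j < n) (a j * x j).

(* A : R^{n x m}, given by its columns A i = a_i in R^n. *)
Definition Sig (n m : nat) (A : 'I_m -> point n) (c : 'I_m -> R) (x : point n) : R :=
  \big[Rplus/0]_(i < m) (c i * exp (dotR (A i) x)).

Definition C_NNS (n m : nat) (A : 'I_m -> point n) (c : 'I_m -> R) : Prop :=
  forall x : point n, 0 <= Sig A c x.

Definition C_AGE (n m : nat) (A : 'I_m -> point n) (k : 'I_m) (c : 'I_m -> R) : Prop :=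
  C_NNS A c /\ (forall i : 'I_m, i <> k -> 0 <= c i).

Definition C_SAGE (n m : nat) (A : 'I_m -> point n) (c : 'I_m -> R) : Prop :=
  exists cs : 'I_m -> 'I_m -> R,
    (forall k : 'I_m, C_AGE A k (cs k)) /\
    (forall i : 'I_m, c i = \big[Rplus/0]_(k < m) cs k i).

Definition extreme_ray (m : nat) (K : ('I_m -> R) -> Prop) (c : 'I_m -> R) : Prop :=
  K c /\ (exists i : 'I_m, c i <> 0) /\
  (forall u v : 'I_m -> R, K u -> K v -> (forall i, c i = u i + v i) ->
     exists l : R, 0 <= l /\ forall i, u i = l * c i).

Definition lsum (T : Type) (f : T -> R) (l : list T) : R :=
  fold_right (fun x acc => f x + acc) 0 l.

Definition enumerates (n : nat) (S : point n -> Prop) (l : list (point n)) : Prop :=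
  NoDup l /\ forall p, S p <-> In p l.

Definition finite_set (n : nat) (S : point n -> Prop) : Prop :=
  exists l, enumerates S l.

Definition aff_dependent (n : nat) (S : point n -> Prop) : Prop :=
  exists (ps : list (point n)) (lam : point n -> R),
    NoDup ps /\ (forall p, In p ps -> S p) /\
    (exists p, In p ps /\ lam p <> 0) /\
    lsum lam ps = 0 /\
    (forall j : 'I_n, lsum (fun p => lam p * p j) ps = 0).

Definition aff_independent (n : nat) (S : point n -> Prop) : Prop :=
  ~ aff_dependent S.

Definition circuit (n : nat) (S : point n -> Prop) : Prop :=
  finite_set S /\ aff_dependent S /\
  (forall T : point n -> Prop,
     (forall p, T p -> S p) -> (exists p, S p /\ ~ T p) -> aff_independent T).

Definition conv (n : nat) (S : point n -> Prop) (p : point n) : Prop :=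
  exists (ps : list (point n)) (lam : point n -> R),
    (forall q, In q ps -> S q) /\ (forall q, In q ps -> 0 <= lam q) /\
    lsum lam ps = 1 /\
    (forall j : 'I_n, p j = lsum (fun q => lam q * q j) ps).

Definition extreme_point (n : nat) (C : point n -> Prop) (p : point n) : Prop :=
  C p /\
  (forall (x y : point n) (t : R), C x -> C y -> 0 < t < 1 ->
     (forall j, p j = t * x j + (1 - t) * y j) -> x = p /\ y = p).

Definition simplicial_circuit (n : nat) (S : point n -> Prop) : Prop :=
  circuit S /\
  exists (l E : list (point n)),
    enumerates S l /\ enumerates (extreme_point (conv S)) E /\
    length E = (length l - 1)%nat.

Definition singleton_set (n : nat) (S : point n -> Prop) : Prop :=
  exists q : point n, forall p, S p <-> p = q.

(* Main.v *)
From Stdlib Require Import Reals List.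
From mathcomp Require Import all_boot all_order all_algebra.
From mathcomp Require Import all_classical all_reals all_analysis.
From mathcomp Require Import ring lra.
From mathcomp Require Import Rstruct Rstruct_topology.
Require Import Defs.
Set Implicit Arguments. Unset Strict Implicit. Unset Printing Implicit Defensive.

Import Order.TTheory GRing.Theory Num.Theory.
Import numFieldNormedType.Exports.
Local Open Scope classical_set_scope.
Local Open Scope ring_scope.

(** An extreme [c] lies in a single AGE cone, say the [k]-th; if [c >= 0] its support is a singleton, so let [c_k < 0]. Divide the signomial by [exp (a_k . x)] and put [b_i = a_i - a_k]. By extremality no direction [d] satisfies [b_i . d <= 0] for all [i] in the support with some strict inequality (the terms that vanish at infinity along [d] could be split off), so the convex function [sum_(i <> k) c_i exp (b_i . x)] attains its minimum, at some [x0]. If [mu] is any affine dependency of the support, the vectors [(c_i +- eps mu_i exp (- b_i . x0)) / 2] still have [x0] as a critical point, hence lie in the AGE cone for small [eps], and they sum to [c]. Extremality makes [mu_i] proportional to [c_i exp (b_i . x0)]: the support has, up to scaling, a unique affine dependency, negative exactly at [k]. This characterizes simplicial circuits. *)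

(** * Minimization of positive sums of exponentials of linear forms *)

Lemma continuous_sum (R : realType) (T : topologicalType) (I : finType) (F : I -> T -> R) :
  (forall i, continuous (F i)) -> continuous (fun x => \sum_i F i x).
Proof.
by move=> cF; apply: continuous_big => [|i _]; [exact: add_continuous | exact: cF].
Qed.

Lemma rowspace_closed (R : realType) (n m : nat) (B : 'M[R]_(n, m)) :
  closed [set y : 'rV[R]_m | (y <= B)%MS].
Proof.
have -> : [set y : 'rV[R]_m | (y <= B)%MS] =
    \bigcap_(j in [set: 'I_m]) ((fun y : 'rV[R]_m => (y *m cokermx B) 0 j) @^-1` [set 0]).
  apply/seteqP; split => y /=.
    by rewrite submxE => /eqP e j _ /=; rewrite e mxE.
  move=> e; rewrite submxE; apply/eqP/rowP => j; rewrite (e j) ?mxE //.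
apply: closed_bigI => j _; apply: preimage_closed; last exact: closed_eq.
apply: in1W.
rewrite (_ : (fun _ => _) = fun y : 'rV[R]_m => \sum_i y 0 i * cokermx B i j); last first.
  by apply/funext => z; rewrite mxE.
by apply: continuous_sum => i y; apply: continuousM; [exact: (@coord_continuous R 1 m 0 i y) | exact: cst_continuous].
Qed.

(** The left side is the positive part of [t]: a positively homogeneous minorant of [expR], from
    which coercivity will follow. *)
Lemma max0_le_expR (R : realType) (t : R) : (t + `|t|) / 2 <= expR t.
Proof.
have := expR_ge1Dx t; have := expR_gt0 t.
by case: (ler0P t); lra.
Qed.

(* The absence of recession directions makes the function coercive on the row space, although it need not be on ['rV_n]. *)
Lemma sum_expR_attains_min (R : realType) (n m : nat) (B : 'M[R]_(n, m)) (w : 'I_m -> R) :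
  (forall i, 0 < w i) ->
  (forall d : 'rV_n, (forall i, (d *m B) 0 i <= 0) -> d *m B = 0) ->
  exists x : 'rV_n, forall z : 'rV_n,
    \sum_i w i * expR ((x *m B) 0 i) <= \sum_i w i * expR ((z *m B) 0 i).
Proof.
move=> w0 recB.
pose f (y : 'rV[R]_m) := \sum_i w i * expR (y 0 i).
(* Unlike [f], the minorant [g] is positively homogeneous, so a bound on the unit sphere controls
   its growth. *)
pose g (y : 'rV[R]_m) := \sum_i w i * ((y 0 i + `|y 0 i|) / 2).
have cf : continuous f.
  apply: continuous_sum => i y.
  apply: (@continuousM R _ (fun=> w i) (fun y : 'rV[R]_m => expR (y 0 i)) y).
    exact: cst_continuous.
  by apply: continuous_comp; [exact: (@coord_continuous R 1 m 0 i y) | exact: continuous_expR].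
have cg : continuous g.
  apply: continuous_sum => i y.
  apply: (@continuousM R _ (fun=> w i) (fun y : 'rV[R]_m => (y 0 i + `|y 0 i|) / 2) y).
    exact: cst_continuous.
  apply: (@continuousM R _ (fun y : 'rV[R]_m => y 0 i + `|y 0 i|) (fun=> 2^-1) y).
    have cc := @coord_continuous R 1 m 0 i y.
    apply: (@continuousD R R _ (fun y : 'rV[R]_m => y 0 i) (fun y => `|y 0 i|) y) => //.
    by apply: continuous_comp => //; exact: norm_continuous.
  exact: cst_continuous.
have gf y : g y <= f y.
  by apply: ler_sum => i _; rewrite ler_pM2l // max0_le_expR.
have f0 y : 0 <= f y.
  by apply: sumr_ge0 => i _; rewrite mulr_ge0 ?expR_ge0 // ltW.
pose L := [set y : 'rV[R]_m | (y <= B)%MS].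
have cL r : compact (L `&` [set y | `|y| <= r]).
  apply: bounded_closed_compact.
    by exists r; split; [exact: num_real | move=> M rM y [_ /= yr]; exact: le_trans yr (ltW rM)].
  apply: closedI; first exact: rowspace_closed.
  by apply: (@preimage_closed _ _ _ [set x | x <= r]) => [y _|]; [exact: norm_continuous | exact: closed_le].
(* If the row space is zero, its unit sphere is empty and [f] is constant there; this case is
   treated apart. *)
have [[y1 [Ly1 y1n]]|] := pselect (exists y, L y /\ y != 0); last first.
  move=> nL; exists 0 => z.
  have e0 (x : 'rV_n) : x *m B = 0.
    apply: contrapT => /eqP xB; apply: nL; exists (x *m B); split => //.
    exact: submxMl.
  by rewrite !e0.
have Lz (a : R) y : L y -> L (a *: y) by move=> Ly; rewrite /L /=; exact: scalemx_sub.
pose S := L `&` [set y | `|y| = 1].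
have cS : compact S.
  apply: (@subclosed_compact _ _ (L `&` [set y | `|y| <= 1])) => //.
    apply: closedI; first exact: rowspace_closed.
    apply: (@preimage_closed _ _ (fun y : 'rV[R]_m => `|y|) [set x : R | x = 1]) => [y _|].
      exact: norm_continuous.
    exact: closed_eq.
  by move=> y [Ly /= ->]; split => //=.
have S0 : S !=set0.
  exists (`|y1|^-1 *: y1); split; first exact: Lz.
  by rewrite /= normrZ normfV normr_id mulVf // normr_eq0.
have [s + smin] := @EVT_min_rV R m g S S0 cS (@continuous_subspaceT _ _ S g cg).
rewrite inE => -[Ls ns].
(* If [g s] vanished, all coordinates of [s] would be nonpositive, so [s] would be a recession
   direction and hence zero, against its norm being 1. *)
have gs : 0 < g s.
  have gi i : 0 <= w i * ((s 0 i + `|s 0 i|) / 2).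
    by rewrite mulr_ge0 ?(ltW (w0 i)) //; case: (ler0P (s 0 i)); lra.
  rewrite lt_neqAle sumr_ge0 ?andbT => [|i _]; last exact: gi.
  apply/eqP => /esym gs0.
  have si i : s 0 i <= 0.
    have := gs0; rewrite /g => /eqP.
    rewrite psumr_eq0 => [/allP/(_ i (mem_index_enum i))/=|j _]; last exact: gi.
    rewrite mulf_eq0 gt_eqF ?(w0 i) //= => /eqP.
    by case: (ler0P (s 0 i)); lra.
  have /submxP[d sd] := Ls.
  have : s = 0 by rewrite sd recB // => i; rewrite -sd.
  by move=> s0; move: ns; rewrite /= s0 normr0 => /esym/eqP; rewrite oner_eq0.
have gL y : L y -> g s * `|y| <= g y.
  move=> Ly; have [->|y0] := eqVneq y 0.
    by rewrite normr0 mulr0; apply: sumr_ge0 => i _; rewrite mulr_ge0 ?(ltW (w0 i)) // mxE normr0; lra.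
  have ny : 0 < `|y| by rewrite normr_gt0.
  have : g s <= g (`|y|^-1 *: y).
    apply: smin; rewrite inE; split; first exact: Lz.
    by rewrite /= normrZ normfV normr_id mulVf // gt_eqF.
  rewrite -(ler_pM2r ny) => /le_trans; apply.
  rewrite /g mulr_suml; apply: ler_sum => i _.
  rewrite !mxE normrM normfV normr_id.
  by rewrite le_eqVlt; apply/orP; left; apply/eqP; field; rewrite gt_eqF.
(* Since [f] is at least [g s] times the norm on the row space, it exceeds [f 0] beyond radius [r];
   a minimum over the ball is therefore global. *)
pose r := f 0 / g s.
have r0 : 0 <= r by rewrite divr_ge0 // ltW.
have K0 : (L `&` [set y | `|y| <= r]) !=set0.
  by exists 0; split => /=; [exact: sub0mx | rewrite normr0].
have [y + ymin] := @EVT_min_rV R m f _ K0 (cL r) (@continuous_subspaceT _ _ _ f cf).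
rewrite inE => -[/submxP[x yx] _]; exists x => z.
rewrite -yx; have [zr|rz] := leP `|z *m B| r.
  by apply: ymin; rewrite inE; split => //; exact: submxMl.
apply: (le_trans (ymin 0 _)); first by rewrite inE; split => /=; [exact: sub0mx | rewrite normr0].
apply: (@le_trans _ _ (g (z *m B))) => //.
apply: (@le_trans _ _ (g s * `|z *m B|)); last by apply: gL; exact: submxMl.
by move: rz; rewrite /r ltr_pdivrMr // => /ltW; rewrite mulrC.
Qed.

(** The hypothesis makes [s = 0] a minimum of a differentiable function of one variable, and the
    conclusion is that its derivative there vanishes. *)
Lemma sum_expR_critical (R : realType) (m : nat) (v t : 'I_m -> R) :
  (forall s : R, \sum_i v i <= \sum_i v i * expR (s * t i)) ->
  \sum_i v i * t i = 0.
Proof.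
move=> vmin.
pose h := \sum_i (fun s : R => v i * expR (s * t i)).
have hE s : h s = \sum_i v i * expR (s * t i) by rewrite /h fct_sumE.
have dh (s : R) : is_derive s 1 h (\sum_i v i * (t i * expR (s * t i))).
  apply: is_derive_sum => i.
  apply: is_deriveZ; rewrite mulrC.
  apply: (@is_derive1_comp _ expR (fun s => s * t i)).
  have -> : (fun s => s * t i) = t i \*: (id : R -> R) by apply/funext => x; rewrite mulrC.
  by rewrite -[X in is_derive _ _ _ X]mulr1; apply: is_deriveZ.
have m0 : is_derive (0 : R) 1 h 0.
  apply: (@derive1_at_min _ h (-1) 1 0); rewrite ?in_itv /=.
  - lra.
  - by move=> s _; have [] := dh s.
  - lra.
  - move=> s _; rewrite !hE; under eq_bigr do rewrite mul0r exp.expR0 mulr1.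
    exact: vmin.
have := @derive_val _ _ _ _ _ _ _ m0.
rewrite (@derive_val _ _ _ _ _ _ _ (dh 0)) => e; rewrite -[RHS]e.
by apply: eq_bigr => i _; rewrite mul0r exp.expR0 mulr1.
Qed.

(** * Signomials and the AGE and SAGE cones *)

Lemma SigE n m (A : 'I_m -> point n) c x :
  Sig A c x = \sum_i c i * expR (dotR (A i) x).
Proof. by apply: eq_bigr => i _; rewrite RexpE. Qed.

Lemma dotRDr n (a x d : point n) (t : R) :
  dotR a (fun j => x j + t * d j) = dotR a x + t * dotR a d.
Proof.
rewrite /dotR mulr_sumr -big_split /=.
by apply: eq_bigr => j _; rewrite !RmultE; ring.
Qed.

(** Dividing by the positive function [exp (a_k . x)] preserves the sign and moves [a_k] to the
    origin. *)
Lemma C_NNSP n m (A : 'I_m -> point n) (k : 'I_m) c :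
  C_NNS A c <-> forall x, 0 <= \sum_i c i * expR (dotR (A i) x - dotR (A k) x).
Proof.
have E x : \sum_i c i * expR (dotR (A i) x - dotR (A k) x) =
    Sig A c x * expR (- dotR (A k) x).
  rewrite SigE mulr_suml; apply: eq_bigr => i _.
  by rewrite exp.expRD mulrA.
split=> H x.
  by rewrite E mulr_ge0 ?expR_ge0 //; apply/RleP/H.
by apply/RleP; have := H x; rewrite E pmulr_lge0 ?expR_gt0.
Qed.

Lemma C_AGE_ge0 n m (A : 'I_m -> point n) (k : 'I_m) c :
  (forall i, 0 <= c i) -> C_AGE A k c.
Proof.
move=> c0; split=> [|i _]; last exact/RleP.
by apply/(C_NNSP _ k) => x; apply: sumr_ge0 => i _; rewrite mulr_ge0 ?expR_ge0.
Qed.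

Lemma C_AGE_SAGE n m (A : 'I_m -> point n) (k : 'I_m) c :
  C_AGE A k c -> C_SAGE A c.
Proof.
move=> ck; exists (fun j => if j == k then c else fun=> 0); split=> [j|i].
  by case: eqP => [->//|_]; exact: C_AGE_ge0.
rewrite (bigD1 k) //= eqxx big1 ?RplusE ?addr0 // => j /negbTE ->.
by [].
Qed.

Lemma C_AGE_scale n m (A : 'I_m -> point n) (k : 'I_m) (c : 'I_m -> R) (l : R) :
  0 <= l -> C_AGE A k c -> C_AGE A k (fun i => l * c i).
Proof.
move=> l0 [/(C_NNSP _ k) cN c0]; split=> [|i ik]; last first.
  by apply/RleP; rewrite mulr_ge0 //; exact/RleP/c0.
apply/(C_NNSP _ k) => x; under eq_bigr do rewrite -mulrA.
by rewrite -mulr_sumr mulr_ge0.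
Qed.

(** By extremality each AGE summand [cs k] is a multiple of [c]. A nonzero factor puts [c] itself in
    that AGE cone; if all factors were zero, [c] would vanish. *)
Lemma extreme_SAGE_AGE n m (A : 'I_m -> point n) c :
  extreme_ray (C_SAGE A) c -> exists k, C_AGE A k c.
Proof.
case=> -[cs [csA cE]] [[i0 ci0] ext]; apply: contrapT => nA; apply: ci0.
rewrite cE; apply: big1 => k _.
have csS : C_SAGE A (fun i => \sum_(j | j != k) cs j i).
  exists (fun j => if j == k then fun=> 0 else cs j); split=> [j|i].
    by case: eqP => _; [exact: C_AGE_ge0 | exact: csA].
  rewrite [RHS](bigD1 k) //= eqxx RplusE add0r.
  by apply: eq_bigr => j /negbTE ->.
have [|l [/RleP l0 csE]] := ext _ _ (C_AGE_SAGE (csA k)) csS.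
  by move=> i; rewrite cE (bigD1 k).
have [lz|lz] := eqVneq l 0; first by rewrite csE lz RmultE mul0r.
exfalso; apply: nA; exists k.
have -> : c = (fun i => l^-1 * cs k i).
  by apply/funext => i; rewrite csE RmultE mulrA mulVf // mul1r.
by apply: C_AGE_scale; rewrite ?invr_ge0.
Qed.

(* Let [t] tend to infinity in the signomial at [x + t d]. *)
Lemma C_NNS_face n m (A : 'I_m -> point n) (k : 'I_m) (c : 'I_m -> R) (d : point n) :
  C_NNS A c ->
  (forall i, c i != 0 -> dotR (A i) d <= dotR (A k) d) ->
  C_NNS A (fun i => if dotR (A i) d == dotR (A k) d then c i else 0).
Proof.
move=> /(C_NNSP _ k) cN dle; apply/(C_NNSP _ k) => x.
set u := \sum_i _.
pose q i := dotR (A k) d - dotR (A i) d.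
pose e i := expR (dotR (A i) x - dotR (A k) x).
(* As [expR (t * q i)] is at least [t * q i], a decaying term is at most [|c i| * e i / (t * q i)].
   Terms with [q i = 0] add nothing to [M], the inverse of zero being zero. *)
pose M := \sum_i `|c i| * e i / q i.
have M0 : 0 <= M.
  apply: sumr_ge0 => i _; have [->|ci] := eqVneq (c i) 0; first by rewrite normr0 !mul0r.
  by rewrite divr_ge0 ?mulr_ge0 ?expR_ge0 // subr_ge0 dle.
have uM t : 0 < t -> 0 <= u + t^-1 * M.
  move=> t0; apply: le_trans (cN (fun j => x j + t * d j)) _.
  rewrite mulr_sumr -big_split /=; apply: ler_sum => i _.
  rewrite !dotRDr.
  have -> : dotR (A i) x + t * dotR (A i) d - (dotR (A k) x + t * dotR (A k) d) =
     (dotR (A i) x - dotR (A k) x) + - (t * q i) by rewrite /q; ring.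
  rewrite exp.expRD -/(e i) expRN.
  have [->|ci] := eqVneq (c i) 0.
    by rewrite normr0 !mul0r mulr0 addr0; case: ifP => _; rewrite ?mul0r.
  case: eqP => [qi|qi].
    by rewrite /q qi subrr mulr0 exp.expR0 invr1 mulr1 invr0 !mulr0 addr0.
  have q0 : 0 < q i by rewrite subr_gt0 lt_neqAle dle // andbT; apply/eqP.
  rewrite mul0r add0r mulrA.
  apply: (@le_trans _ _ (`|c i| * e i * (expR (t * q i))^-1)).
    by rewrite ler_wpM2r ?invr_ge0 ?expR_ge0 // ler_wpM2r ?expR_ge0 // ler_norm.
  rewrite mulrCA; apply: ler_wpM2l; first by rewrite mulr_ge0 ?expR_ge0.
  rewrite -invfM lef_pV2 ?posrE ?expR_gt0 ?mulr_gt0 //.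
  by apply: le_trans (expR_ge1Dx _); lra.
rewrite leNgt; apply/negP => u0.
have M1 : 0 < M + 1 by lra.
(* This [t] turns the lower bound into [u / (M + 1)], which is negative. *)
have := uM ((M + 1) / - u) (divr_gt0 M1 _); rewrite oppr_gt0 => /(_ u0).
rewrite invf_div mulrAC -mulrA.
have -> : u + - u * (M / (M + 1)) = u / (M + 1).
  by field; rewrite gt_eqF.
by rewrite pmulr_lge0 ?invr_gt0 //; lra.
Qed.

(* Tangent-line inequality for the exponential at [x0]. *)
Lemma C_NNS_tangent n m (A : 'I_m -> point n) (k : 'I_m) (c : 'I_m -> R) (x0 : point n) :
  let v i := c i * expR (dotR (A i) x0 - dotR (A k) x0) in
  (forall i, i != k -> 0 <= c i) ->
  (forall j, \sum_i v i * (A i j - A k j) = 0) -> 0 <= \sum_i v i ->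
  C_NNS A c.
Proof.
move=> v c0 vA v0; apply/(C_NNSP _ k) => x.
apply: (le_trans v0).
pose b i y := dotR (A i) y - dotR (A k) y.
have bE i y : b i y = \sum_j (A i j - A k j) * y j.
  rewrite /b /dotR -sumrB; apply: eq_bigr => j _.
  by rewrite !RmultE; ring.
have vb y : \sum_i v i * b i y = 0.
  under eq_bigr do rewrite bE mulr_sumr.
  rewrite exchange_big /= big1 // => j _.
  by under eq_bigr do rewrite mulrA; rewrite -mulr_suml vA mul0r.
(* The added terms sum to zero by criticality, which permits a term-by-term comparison. At [i = k]
   both sides equal [c k], whatever its sign. *)
have -> : \sum_i v i = \sum_i (v i + (v i * b i x - v i * b i x0)).
  by rewrite big_split /= sumrB !vb subrr addr0.
apply: ler_sum => i _; have [->|ik] := eqVneq i k.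
  by rewrite /v /b !subrr exp.expR0; lra.
rewrite -/(b i x) /v -/(b i x0).
have -> : expR (b i x) = expR (b i x0) * expR (b i x - b i x0).
  by rewrite -exp.expRD addrC subrK.
have := expR_ge1Dx (b i x - b i x0).
move/(ler_wpM2l (mulr_ge0 (c0 i ik) (expR_ge0 (b i x0)))).
by lra.
Qed.

(** * Extreme rays: recession directions, critical point, unique dependency *)

(** Split [c] into its terms [u] on the face exposed by [d] and the remaining terms [v], which are
    nonnegative. Both lie in the SAGE cone, so [u] is a multiple of [c]; the coordinate [k] shows
    the factor is 1, so [v] is zero. *)
Lemma extreme_no_recession n m (A : 'I_m -> point n) (k : 'I_m) (c : 'I_m -> R) (d : point n) :
  extreme_ray (C_SAGE A) c -> C_AGE A k c -> c k != 0 ->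
  (forall i, c i != 0 -> dotR (A i) d <= dotR (A k) d) ->
  forall i, c i != 0 -> dotR (A i) d = dotR (A k) d.
Proof.
move=> [_ [_ ext]] [cN c0] ck dle i ci.
pose u i := if dotR (A i) d == dotR (A k) d then c i else 0.
pose v i := if dotR (A i) d == dotR (A k) d then 0 else c i.
have cge (j : 'I_m) : j != k -> 0 <= c j by move=> /eqP /c0 /RleP.
have uS : C_SAGE A u.
  apply: (@C_AGE_SAGE _ _ _ k); split; first exact: C_NNS_face.
  by move=> j /eqP jk; apply/RleP; rewrite /u; case: ifP => _ //; exact: cge.
have vS : C_SAGE A v.
  apply: (@C_AGE_SAGE _ _ _ k); apply: C_AGE_ge0 => j; rewrite /v.
  by case: eqP => // dj; apply: cge; apply: contra_notN dj => /eqP ->.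
have [|l [_ lE]] := ext u v uS vS.
  by move=> j; rewrite /u /v; case: ifP => _; rewrite RplusE ?addr0 ?add0r.
have l1 : l = 1.
  have := lE k; rewrite /u eqxx RmultE -{1}[c k]mul1r => /(mulIf ck).
  by [].
apply/eqP; have := lE i; rewrite /u l1 RmultE mul1r.
by case: ifP => // _ /esym /eqP; rewrite (negbTE ci).
Qed.

Lemma extreme_critical_point n m (A : 'I_m -> point n) (k : 'I_m) (c : 'I_m -> R) :
  extreme_ray (C_SAGE A) c -> C_AGE A k c -> c k != 0 ->
  exists x0 : point n,
    forall j, \sum_i c i * expR (dotR (A i) x0 - dotR (A k) x0) * (A i j - A k j) = 0.
Proof.
move=> cext cA ck; have cge (j : 'I_m) : j != k -> 0 <= c j.
  by move=> /eqP jk; case: cA => _ /(_ j jk) /RleP.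
pose I i := (i != k) && (c i != 0).
(* Indices outside [I] get a zero column and weight 1: they only add constants to the objective,
   while all weights stay positive. *)
pose B : 'M[R]_(n, m) := \matrix_(j, i) if I i then A i j - A k j else 0.
pose w i : R := if I i then c i else 1.
have BE (d : 'rV_n) i : I i -> (d *m B) 0 i = dotR (A i) (d 0) - dotR (A k) (d 0).
  move=> Ii; rewrite mxE /dotR -sumrB; apply: eq_bigr => j _.
  by rewrite mxE Ii !RmultE; ring.
have B0 (d : 'rV_n) i : ~~ I i -> (d *m B) 0 i = 0.
  by move=> Ii; rewrite mxE big1 // => j _; rewrite mxE (negbTE Ii) mulr0.
have w0 i : 0 < w i.
  by rewrite /w; case: ifP => // /andP[ik ci]; rewrite lt_neqAle eq_sym ci cge.
have [d dB|x xmin] := @sum_expR_attains_min R n m B w w0.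
  apply/rowP => i; rewrite [RHS]mxE; have [Ii|/B0->//] := boolP (I i).
  have /andP[_ ci] := Ii; apply/eqP; rewrite BE // subr_eq0; apply/eqP.
  apply: (extreme_no_recession cext cA ck) => // {Ii}i {}ci.
  have [->|ik] := eqVneq i k; first exact: lexx.
  by have := dB i; rewrite BE ?subr_le0 // /I ik.
exists (x 0) => j.
(* Row [j] of [B] is the rate of change of the exponents along the [j]-th coordinate axis. *)
have := @sum_expR_critical _ _ (fun i => w i * expR ((x *m B) 0 i)) (B j).
move=> crit; rewrite -[RHS]crit => [|s]; last first.
  apply: (le_trans (xmin (x + s *: delta_mx 0 j))); apply: ler_sum => i _.
  by rewrite mulmxDl -scalemxAl -rowE !mxE exp.expRD mulrA.
apply: eq_bigr => i _; have [Ii|nI] := boolP (I i).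
  by rewrite BE // [B j i]mxE /w Ii.
rewrite [B j i]mxE (negbTE nI) mulr0.
move: nI; rewrite negb_and !negbK => /orP[] /eqP ->; first by rewrite [A k j - _]subrr mulr0.
by rewrite !mul0r.
Qed.

Definition aff_dependency n m (A : 'I_m -> point n) (mu : 'I_m -> R) : Prop :=
  \sum_i mu i = 0 /\ forall j, \sum_i mu i * A i j = 0.

(** Coefficient form of a simplicial circuit: the support of [v] carries a single affine dependency
    up to scaling, and its only negative coefficient is at [k], so that [A k] is a convex
    combination of the other points. *)
Record simplicial_dependency n m (A : 'I_m -> point n) (k : 'I_m) (v : 'I_m -> R) : Prop := {
  dependency_lt0 : v k < 0;
  dependency_ge0 : forall i, i != k -> 0 <= v i;
  dependency_eq0 : aff_dependency A v;
  dependency_unique : forall mu : 'I_m -> R, (forall i, v i = 0 -> mu i = 0) ->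
    aff_dependency A mu -> exists s, forall i, mu i = s * v i }.

(* Tilting [c] along an affine dependency [mu] in both directions stays in the AGE cone, so extremality forces [mu] to be proportional to the weights of [c] at the critical point. *)
Lemma extreme_dependency n m (A : 'I_m -> point n) (k : 'I_m) (c : 'I_m -> R) :
  extreme_ray (C_SAGE A) c -> C_AGE A k c -> c k < 0 ->
  exists2 v : 'I_m -> R, forall i, (v i == 0) = (c i == 0) & simplicial_dependency A k v.
Proof.
move=> cext cA ck; have ck0 : c k != 0 by rewrite lt_eqF.
have cge (j : 'I_m) : j != k -> 0 <= c j.
  by move=> /eqP jk; case: cA => _ /(_ j jk) /RleP.
have [x0 crit] := extreme_critical_point cext cA ck0.
pose e i := expR (dotR (A i) x0 - dotR (A k) x0).
pose v i := c i * e i.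
have e0 i : 0 < e i by exact: expR_gt0.
have ek : e k = 1 by rewrite /e subrr exp.expR0.
have sv : 0 <= \sum_i v i by case: cA => /(C_NNSP _ k)/(_ x0).
have prop (mu : 'I_m -> R) : (forall i, c i = 0 -> mu i = 0) ->
    \sum_i mu i = 0 -> (forall j, \sum_i mu i * A i j = 0) ->
    exists s, forall i, mu i = s * v i.
  move=> mu0 smu muA.
  (* [M] dominates every ratio of [mu] to [v] on the support, and the summand 1 keeps it
     positive. *)
  pose M := 1 + \sum_i `|mu i| / `|v i|.
  have M1 : 0 < M by rewrite ltr_pwDl // sumr_ge0 // => i _; rewrite divr_ge0.
  have muM i : `|mu i| <= M * `|v i|.
    have [ci|ci] := eqVneq (c i) 0; first by rewrite mu0 // normr0 mulr_ge0 // ltW.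
    rewrite -ler_pdivrMr ?normr_gt0 ?mulf_neq0 ?(gt_eqF (e0 i)) //.
    rewrite /M (bigD1 i) //= addrCA lerDl addr_ge0 ?ler01 // sumr_ge0 //.
  (* Dividing [mu i] by [e i] makes the weights of [d a] at [x0] equal to
     [(v i + a * mu i / M) / 2], so [x0] remains critical. *)
  pose d (a : R) i := (c i + a * (mu i / e i) / M) / 2.
  have dS a : a = 1 \/ a = -1 -> C_SAGE A (d a).
    move=> a1; have na : `|a| = 1 by case: a1 => ->; rewrite ?normrN normr1.
    have dge j : j != k -> 0 <= d a j.
      move=> jk; rewrite /d divr_ge0 ?ler0n // -(pmulr_lge0 _ (e0 j)).
      have -> : (c j + a * (mu j / e j) / M) * e j = v j + a * mu j / M.
        by rewrite /v; field; rewrite !gt_eqF.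
      have : `|a * mu j / M| <= v j.
        rewrite normrM normfV (gtr0_norm M1) ler_pdivrMr // normrM na mul1r.
        rewrite mulrC -[v j]ger0_norm; first exact: muM.
        by rewrite mulr_ge0 ?cge // ltW.
      by rewrite ler_norml => /andP[]; lra.
    apply: (@C_AGE_SAGE _ _ _ k); split; last by move=> j /eqP /dge /RleP.
    have dE i : d a i * e i = (v i + a * mu i / M) / 2.
      by rewrite /d /v; field; rewrite !gt_eqF.
    apply: (@C_NNS_tangent _ _ _ k _ x0) => // [j|]; last first.
      under eq_bigr do rewrite dE.
      rewrite -mulr_suml big_split /= -mulr_suml -mulr_sumr smu mulr0 mul0r addr0.
      by rewrite divr_ge0.
    have muk : \sum_i mu i * (A i j - A k j) = 0.
      under eq_bigr do rewrite mulrBr.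
      by rewrite sumrB muA -mulr_suml smu mul0r subrr.
    transitivity (2^-1 * \sum_i v i * (A i j - A k j) +
        a / M / 2 * \sum_i mu i * (A i j - A k j)).
      rewrite !mulr_sumr -big_split; apply: eq_bigr => i _.
      rewrite -/(e i) dE /=; field; rewrite gt_eqF //.
    by rewrite crit muk !mulr0 addr0.
  have [_ [_ ext]] := cext.
  have [|l [_ lE]] := ext _ _ (dS 1 (or_introl erefl)) (dS (-1) (or_intror erefl)).
    by move=> i; rewrite /d RplusE; field; rewrite !gt_eqF.
  exists (M * (2 * l - 1)) => i.
  have := lE i; rewrite /d RmultE => h.
  have -> : mu i = M * e i * (2 * ((c i + 1 * (mu i / e i) / M) / 2) - c i).
    by field; rewrite !gt_eqF.
  by rewrite h /v; ring.
(* Criticality says only that the vectors [A i - A k] weighted by [v] cancel. Subtracting the total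
   [T] at [k] gives an affine dependency [nu], still negative at [k] because [T] is nonnegative. *)
pose T := \sum_i v i.
pose nu i := v i - (if i == k then T else 0).
have nu_sum (F : 'I_m -> R) : \sum_i nu i * F i = \sum_i v i * F i - T * F k.
  under eq_bigr do rewrite mulrBl.
  rewrite sumrB; congr (_ - _).
  rewrite (bigD1 k) //= eqxx big1 ?addr0 // => i /negbTE ->.
  by rewrite mul0r.
have snu : \sum_i nu i = 0.
  have := nu_sum (fun=> 1); under eq_bigr do rewrite mulr1.
  by move=> ->; under eq_bigr do rewrite mulr1; rewrite mulr1 subrr.
have nuA j : \sum_i nu i * A i j = 0.
  rewrite nu_sum /T mulr_suml -sumrB -[RHS](crit j).
  by apply: eq_bigr => i _; rewrite mulrBr.
have nu0 i : c i = 0 -> nu i = 0.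
  move=> ci; rewrite /nu /v ci mul0r; case: eqP => [ik|]; last by rewrite subrr.
  by move: ck0; rewrite -ik ci eqxx.
have nuk : nu k < 0.
  by rewrite /nu eqxx /v ek mulr1 -/T; have : 0 <= T by []; lra.
have nuE i : i != k -> nu i = v i by move=> /negbTE ik; rewrite /nu ik subr0.
have nuc i : (nu i == 0) = (c i == 0).
  have [->|ik] := eqVneq i k; first by rewrite !lt_eqF.
  by rewrite nuE // mulf_eq0 (gt_eqF (e0 i)) orbF.
exists nu => //; split=> // [i ik|mu mu0 [smu muA]].
  by rewrite nuE // mulr_ge0 ?cge // ltW.
(* [nu] is itself a multiple of [v], with nonzero factor since [nu k < 0]; proportionality to [v]
   thus becomes proportionality to [nu]. *)
have [t tE] := prop nu nu0 snu nuA.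
have [i ci|s sE] := prop mu _ smu muA; first by apply/mu0/eqP; rewrite nuc ci.
have t0 : t != 0 by apply: contraTneq nuk => t0; rewrite tE t0 mul0r ltxx.
by exists (s / t) => i; rewrite sE tE mulrA divfK.
Qed.

(** * From weights on lists of points to weights on indices *)

Lemma In_mapP (T : eqType) (U : Type) (f : T -> U) (s : seq T) (p : U) :
  In p (map f s) <-> exists2 i, i \in s & p = f i.
Proof.
rewrite in_map_iff; split=> [[i [<- si]]|[i si ->]]; exists i => //.
  by elim: s si => //= x s IHs [->|/IHs]; rewrite inE ?eqxx // => ->; rewrite orbT.
split=> //; elim: s si => //= x s IHs; rewrite inE => /orP[/eqP ->|/IHs]; by [left|right].
Qed.

Lemma NoDup_map_uniq (T : eqType) (U : Type) (f : T -> U) (s : seq T) :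
  injective f -> uniq s -> NoDup (map f s).
Proof.
move=> fI; elim: s => [_|x s IHs /= /andP[xs us]]; constructor; last exact: IHs.
by move=> /In_mapP[i si /fI xi]; rewrite xi si in xs.
Qed.

Lemma lsum_map (T U : Type) (f : T -> U) (F : U -> R) (s : seq T) :
  lsum F (map f s) = \sum_(i <- s) F (f i).
Proof. by elim: s => [|x s IHs]; rewrite ?big_nil // big_cons -IHs. Qed.

Lemma eq_lsum (U : Type) (F G : U -> R) (s : list U) : F =1 G -> lsum F s = lsum G s.
Proof. by move=> FG; elim: s => //= x s ->; rewrite FG. Qed.

Definition subfamily n m (A : 'I_m -> point n) (P : pred 'I_m) (p : point n) : Prop :=
  exists i, P i /\ p = A i.

(** Turns index weights into the functions on points that [aff_dependent] and [conv] require; for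
    injective [A] the sum has at most one term. *)
Definition point_weight n m (A : 'I_m -> point n) (al : 'I_m -> R) (p : point n) : R :=
  \sum_(i | `[< A i = p >]) al i.

Lemma point_weightE n m (A : 'I_m -> point n) (al : 'I_m -> R) i :
  injective A -> point_weight A al (A i) = al i.
Proof.
move=> hA; rewrite /point_weight (big_pred1 i) // => j /=.
by apply/asboolP/eqP => [/hA|->].
Qed.

Lemma lsum_point_weight n m (A : 'I_m -> point n) (P : pred 'I_m) (al : 'I_m -> R)
    (F : point n -> R) :
  injective A -> (forall i, ~~ P i -> al i = 0) ->
  lsum (fun p => point_weight A al p * F p) (map A (enum P)) = \sum_i al i * F (A i).
Proof.
move=> hA alP; rewrite lsum_map big_enum /= [RHS](bigID P) /=.
rewrite [X in _ = _ + X]big1 ?addr0 => [|i /alP ->]; last by rewrite mul0r.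
by apply: eq_bigr => i _; rewrite point_weightE.
Qed.

Lemma enumerates_subfamily n m (A : 'I_m -> point n) (P : pred 'I_m) :
  injective A -> enumerates (subfamily A P) (map A (enum P)).
Proof.
move=> hA; split; first exact: NoDup_map_uniq (enum_uniq _).
move=> p; rewrite In_mapP; split=> [[i [Pi ->]]|[i]].
  by exists i => //; rewrite mem_enum.
by rewrite mem_enum => Pi ->; exists i.
Qed.

(** The lists in [conv] may repeat points, so the weights of all occurrences are added; only for a
    list without repetition is [lam] recovered. *)
Lemma list_weights n m (A : 'I_m -> point n) (lam : point n -> R) (ps : list (point n)) :
  injective A -> (forall p, In p ps -> exists i, p = A i) ->
  exists al : 'I_m -> R,
    [/\ forall i, al i != 0 -> In (A i) ps,
        (forall q, In q ps -> 0 <= lam q) -> forall i, 0 <= al i,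
        NoDup ps -> forall i, In (A i) ps -> al i = lam (A i) &
        forall F, lsum (fun q => lam q * F q) ps = \sum_i al i * F (A i)].
Proof.
move=> hA; elim: ps => [_|q ps IHps qA].
  exists (fun=> 0); split=> // [i|F]; first by rewrite eqxx.
  by rewrite big1 // => i _; rewrite mul0r.
have [p pps|al [al0 alge alE alF]] := IHps; first by apply: qA; right.
have [i0 qE] := qA q (or_introl erefl).
exists (fun i => al i + (if i == i0 then lam q else 0)); split.
- move=> i; have [->|_] := eqVneq i i0; first by left.
  by rewrite addr0 => /al0; right.
- move=> lam0 i; rewrite addr_ge0 //; first by apply: alge => p pps; apply: lam0; right.
  by case: eqP => // _; apply: lam0; left.
- move=> /NoDup_cons_iff [qps /alE {}alE] i.
  case: eqP => [->|ii0] /=; last first.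
    by case=> [|h]; [rewrite qE => /hA/esym | rewrite addr0 alE].
  rewrite -qE => _; rewrite (_ : al i0 = 0) ?add0r //.
  by apply: contrapT => /eqP /al0; rewrite -qE.
- move=> F; rewrite /= alF RplusE addrC.
  under [RHS]eq_bigr do rewrite mulrDl.
  rewrite big_split /=; congr (_ + _).
  by rewrite (bigD1 i0) //= eqxx -qE big1 ?addr0 // => i /negbTE ->; rewrite mul0r.
Qed.

Lemma conv_subfamilyP n m (A : 'I_m -> point n) (P : pred 'I_m) (p : point n) :
  injective A ->
  conv (subfamily A P) p <-> exists al : 'I_m -> R,
    [/\ forall i, ~~ P i -> al i = 0, forall i, 0 <= al i, \sum_i al i = 1 &
        forall j, p j = \sum_i al i * A i j].
Proof.
move=> hA; split=> [[ps [lam [psS [lam0 [slam pE]]]]]|[al [alP al0 sal pE]]].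
  have [q /psS[i [_ ->]]|al [alps alge _ alF]] := list_weights lam hA (ps := ps).
    by exists i.
  exists al; split=> [i||| j].
  - move=> nPi; apply: contrapT => /eqP /alps /psS [i' [Pi' /hA ii']].
    by rewrite ii' Pi' in nPi.
  - by apply: alge => q /lam0 /RleP.
  - rewrite -[RHS]slam -(@eq_lsum _ (fun q => lam q * 1)) ?alF => [|q]; last exact: mulr1.
    by under [RHS]eq_bigr do rewrite mulr1.
  - by rewrite pE alF.
exists (map A (enum P)), (point_weight A al); split; [|split; [|split]].
- by move=> q /(enumerates_subfamily _ hA).2.
- by move=> q /In_mapP[i _ ->]; apply/RleP; rewrite point_weightE.
- rewrite -[RHS]sal -(@eq_lsum _ (fun q => point_weight A al q * 1)) => [|q]; last exact: mulr1.
  by rewrite lsum_point_weight //; under eq_bigr do rewrite mulr1.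
- by move=> j; rewrite lsum_point_weight.
Qed.

(** * Circuits and extreme points obtained from a simplicial dependency *)

(** A dependency of a proper subset is a multiple of [v]; a nonzero factor would give every point of
    the support a nonzero weight, including the omitted one. *)
Lemma simplicial_dependency_circuit n m (A : 'I_m -> point n) (k : 'I_m) (v : 'I_m -> R) :
  injective A -> simplicial_dependency A k v ->
  circuit (subfamily A (fun i => v i != 0)).
Proof.
move=> hA [vk v0 [sv vA] uniqv]; set P : pred 'I_m := fun i => v i != 0.
have enumP := enumerates_subfamily P hA.
have vP i : ~~ P i -> v i = 0 by move=> /negPn/eqP.
split; first by exists (map A (enum P)).
split.
  exists (map A (enum P)), (point_weight A v); split; first by case: enumP.
  split; first by move=> p /enumP.2.
  split.
    exists (A k); split; first by apply/enumP.2; exists k; rewrite /P lt_eqF.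
    by rewrite point_weightE // => vk0; rewrite vk0 ltxx in vk.
  split=> [|j]; last by rewrite lsum_point_weight.
  rewrite -(@eq_lsum _ (fun q => point_weight A v q * 1)) => [|q]; last exact: mulr1.
  by rewrite lsum_point_weight //; under eq_bigr do rewrite mulr1.
move=> T TS [p0 [[i0 [Pi0 ->]] nT]] [ps [lam [ndps [psT [[p [pps lamp]] [slam lamA]]]]]].
have psS q : In q ps -> exists i, q = A i by move=> /psT /TS [i [_ ->]]; exists i.
have [al [alps _ alE alF]] := list_weights lam hA psS.
have [i vi||s sE] := uniqv al.
- apply: contrapT => /eqP /alps /psT /TS [i' [Pi' /hA ii']].
  by rewrite /P -ii' vi eqxx in Pi'.
- split=> [|j]; last by rewrite -[RHS](lamA j) alF.
  rewrite -[RHS]slam -(@eq_lsum _ (fun q => lam q * 1)) ?alF => [|q]; last exact: mulr1.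
  by under [RHS]eq_bigr do rewrite mulr1.
- have s0 : s = 0.
    apply/eqP; apply: contrapT => /negP s0; apply: nT; apply: psT; apply: alps.
    by rewrite sE mulf_neq0.
  have [i pA] := psS p pps; apply: lamp.
  by rewrite pA -alE -?pA // sE s0 mul0r.
Qed.

(* The point [A k] is a convex combination of the others, so it can be eliminated. *)
Lemma conv_without_vertex n m (A : 'I_m -> point n) (k : 'I_m) (v : 'I_m -> R) p :
  injective A -> simplicial_dependency A k v ->
  conv (subfamily A (fun i => v i != 0)) p -> exists al : 'I_m -> R,
    [/\ forall i, v i = 0 -> al i = 0, al k = 0, forall i, 0 <= al i, \sum_i al i = 1 &
        forall j, p j = \sum_i al i * A i j].
Proof.
move=> hA [vk v0 [sv vA] _] /(conv_subfamilyP _ _ hA) [al [alP al0 sal pE]].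
(* The multiple of [v] is chosen to cancel the weight at [k]. Its factor [al k / v k] is
   nonpositive, so the other weights do not decrease. *)
exists (fun i => al i - al k / v k * v i); split=> [i vi||i||j].
- by rewrite vi mulr0 subr0 alP // vi eqxx.
- by rewrite divfK ?subrr // lt_eqF.
- have [->|ik] := eqVneq i k; first by rewrite divfK ?subrr // lt_eqF.
  rewrite subr_ge0 (@le_trans _ _ 0) // -oppr_ge0 -mulNr mulr_ge0 ?v0 //.
  by rewrite -mulrN mulr_ge0 // -invrN invr_ge0 oppr_ge0 ltW.
- by rewrite sumrB -mulr_sumr sv mulr0 subr0.
- under eq_bigr do rewrite mulrBl -[_ * v _ * _]mulrA.
  by rewrite sumrB  -mulr_sumr vA mulr0 subr0.
Qed.

(** Write both endpoints without [A k]. Their mixed weights minus the indicator of [i] form an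
    affine dependency that is zero at [k], hence zero; by nonnegativity both endpoints put all
    weight on [i]. *)
Lemma vertex_extreme n m (A : 'I_m -> point n) (k : 'I_m) (v : 'I_m -> R) i :
  injective A -> simplicial_dependency A k v -> v i != 0 -> i != k ->
  extreme_point (conv (subfamily A (fun i => v i != 0))) (A i).
Proof.
move=> hA dv vi ik; have [vk v0 _ uniqv] := dv; split.
  apply/(conv_subfamilyP _ _ hA); exists (fun j => (j == i)%:R); split=> [j||| j].
  - by have [->|//] := eqVneq j i; rewrite vi.
  - by move=> j; rewrite ler0n.
  - by rewrite (bigD1 i) //= eqxx big1 ?addr0 // => j /negbTE ->.
  - by rewrite (bigD1 i) //= eqxx mul1r big1 ?addr0 // => l /negbTE ->; rewrite mul0r.
move=> x y t /(conv_without_vertex hA dv) [al [alv alk al0 sal xE]].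
move=> /(conv_without_vertex hA dv) [be [bev bek be0 sbe yE]] [/RltP t0 /RltP t1] AE.
pose mu j := t * al j + (1 - t) * be j - (j == i)%:R.
have [j vj||s sE] := uniqv mu.
- rewrite /mu alv // bev //; case: eqP => [ji|_]; first by rewrite -ji vj eqxx in vi.
  by rewrite !mulr0 addr0 subr0.
- have muF (F : 'I_m -> R) :
      \sum_j mu j * F j = t * (\sum_j al j * F j) + (1 - t) * (\sum_j be j * F j) - F i.
    have -> : F i = \sum_j (j == i)%:R * F j.
      by rewrite (bigD1 i) //= eqxx mul1r big1 ?addr0 // => l /negbTE ->; rewrite mul0r.
    rewrite !mulr_sumr -big_split -sumrB /=; apply: eq_bigr => j _.
    by rewrite /mu; ring.
  split=> [|j].
    have e1 (G : 'I_m -> R) : \sum_j G j * 1 = \sum_j G j.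
      by apply: eq_bigr => j _; rewrite mulr1.
    by have := muF (fun=> 1); rewrite !e1 sal sbe => ->; ring.
  by rewrite muF -xE -yE AE; apply: subrr.
have s0 : s = 0.
  have := sE k; rewrite /mu alk bek eq_sym (negbTE ik) !mulr0 addr0 subr0.
  by move=> /esym/eqP; rewrite mulf_eq0 (lt_eqF vk) orbF => /eqP.
have mu0 j : j != i -> t * al j + (1 - t) * be j = 0.
  by move=> ji; have := sE j; rewrite s0 mul0r /mu (negbTE ji) subr0.
have vertex (ga : 'I_m -> R) z : (forall j, j != i -> ga j = 0) -> \sum_j ga j = 1 ->
    (forall j, z j = \sum_l ga l * A l j) -> z = A i.
  move=> ga0 sga zE; have gai : ga i = 1.
    by rewrite -[RHS]sga (bigD1 i) //= big1 ?addr0.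
  apply/funext => j; rewrite zE (bigD1 i) //= gai mul1r big1 ?addr0 // => l /ga0 ->.
  by rewrite mul0r.
have t1' : 0 < 1 - t by rewrite subr_gt0.
split; [apply: (vertex al) => // j ji | apply: (vertex be) => // j ji].
all: have h1 : 0 <= t * al j by rewrite mulr_ge0 // ltW.
all: have h2 : 0 <= (1 - t) * be j by rewrite mulr_ge0 // ltW.
all: have /eqP := mu0 j ji; rewrite paddr_eq0 // !mulf_eq0 => /andP[].
  by rewrite (gt_eqF t0) => /eqP.
by rewrite (gt_eqF t1') => _ /eqP.
Qed.

(** Take [i] with positive weight in [p]. Unless that weight is 1, [p] lies strictly between [A i]
    and the renormalized rest [x], and extremality gives [A i = p]. *)
Lemma extreme_vertex n m (A : 'I_m -> point n) (k : 'I_m) (v : 'I_m -> R) p :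
  injective A -> simplicial_dependency A k v ->
  extreme_point (conv (subfamily A (fun i => v i != 0))) p ->
  exists i, (v i != 0) && (i != k) /\ p = A i.
Proof.
move=> hA dv [/(conv_without_vertex hA dv) [al [alv alk al0 sal pE]] ext].
have [i ali] : exists i, al i != 0.
  apply: contrapT => nal; have := oner_neq0 R; rewrite -sal big1 ?eqxx // => i _.
  by apply: contrapT => /eqP ali; apply: nal; exists i.
have vi : v i != 0 by apply: contraNneq ali => /alv ->.
have ik : i != k by apply: contraNneq ali => ->; rewrite alk.
exists i; split; first by rewrite vi.
have ali0 : 0 < al i by rewrite lt_neqAle eq_sym ali al0.
have sal' : \sum_(j | j != i) al j = 1 - al i by apply/eqP; rewrite eq_sym subr_eq -sal (bigD1 i) //= addrC.
have [ali1|ali1] := eqVneq (al i) 1.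
  have z j : j != i -> al j = 0.
    move=> ji; apply/eqP.
    have /eqP := sal'; rewrite ali1 subrr psumr_eq0 // => /allP/(_ j (mem_index_enum j)).
    by rewrite ji.
  apply/funext => j; rewrite pE (bigD1 i) //= ali1 mul1r big1 ?addr0 // => l /z ->.
  by rewrite mul0r.
have r0 : 0 < 1 - al i.
  rewrite lt_neqAle eq_sym subr_eq0 eq_sym ali1 -sal' sumr_ge0 //.
pose x j := (1 - al i)^-1 * \sum_(l | l != i) al l * A l j.
have [|||j|-> _ //] := ext (A i) x (al i).
- by have [] := vertex_extreme hA dv vi ik.
- apply/(conv_subfamilyP _ _ hA).
  exists (fun l => if l == i then 0 else (1 - al i)^-1 * al l); split=> [l /negPn/eqP vl|l||j].
  + by rewrite /= (alv l vl) mulr0 if_same.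
  + by case: eqP => // _; rewrite mulr_ge0 // invr_ge0 ltW.
  + rewrite (bigD1 i) //= eqxx add0r.
    under eq_bigr => l /negbTE -> do [].
    by rewrite -mulr_sumr sal' mulVf // gt_eqF.
  + rewrite (bigD1 i) //= eqxx mul0r add0r /x mulr_sumr.
    by apply: eq_bigr => l /negbTE ->; rewrite mulrA.
- by split; apply/RltP => //; rewrite -subr_gt0.
- rewrite pE (bigD1 i) //=; congr (_ + _).
  by rewrite /x RmultE RminusE mulrA divff ?mul1r // gt_eqF.
Qed.

Lemma simplicial_dependency_simplicial_circuit n m (A : 'I_m -> point n) (k : 'I_m) (v : 'I_m -> R) :
  injective A -> simplicial_dependency A k v ->
  simplicial_circuit (subfamily A (fun i => v i != 0)).
Proof.
move=> hA dv; split; first exact: simplicial_dependency_circuit dv.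
set P : pred 'I_m := fun i => v i != 0.
pose Q : pred 'I_m := fun i => (v i != 0) && (i != k).
exists (map A (enum P)), (map A (enum Q)).
split; first exact: enumerates_subfamily.
have [ndQ inQ] := enumerates_subfamily Q hA.
split.
  split=> // p; rewrite -inQ; split; first exact: extreme_vertex dv.
  by move=> [i [/andP[vi ik] ->]]; exact: vertex_extreme dv vi ik.
have sz (B : pred 'I_m) : length (map A (enum B)) = #|B|.
  by rewrite -[LHS]/(size _) size_map -cardE.
have kP : P k by rewrite /P (lt_eqF (dependency_lt0 dv)).
(* The extreme points are the support with [k] alone removed. *)
by rewrite !sz (cardD1x kP) subn1.
Qed.

(** * The nonnegative case and the conclusion *)

(** Nonnegative vectors all lie in the SAGE cone, so a nonzero coordinate of [c] can be split off,
    and extremality makes it the only one. *)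
Lemma extreme_ge0_singleton n m (A : 'I_m -> point n) (c : 'I_m -> R) :
  extreme_ray (C_SAGE A) c -> (forall i, 0 <= c i) ->
  singleton_set (fun p => exists i, c i <> 0 /\ p = A i).
Proof.
move=> [_ [[i0 ci0] ext]] c0.
have S (d : 'I_m -> R) : (forall i, 0 <= d i) -> C_SAGE A d.
  by move=> d0; exact/(@C_AGE_SAGE _ _ _ i0)/C_AGE_ge0.
have [|||l [_ lE]] := ext (fun i => if i == i0 then c i else 0)
    (fun i => if i == i0 then 0 else c i).
- by apply: S => i; case: ifP.
- by apply: S => i; case: ifP.
- by move=> i; case: ifP => _; rewrite RplusE ?addr0 ?add0r.
have l1 : l = 1.
  by have := lE i0; rewrite eqxx RmultE -{1}[c i0]mul1r => /(mulIf (introN eqP ci0)).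
exists (A i0) => p; split=> [[i [ci ->]]|->]; last by exists i0.
by have := lE i; rewrite l1 RmultE mul1r; case: eqP => [->|_ /esym].
Qed.

Local Open Scope R_scope.

Theorem mainTheorem4 (n m : nat) (A : 'I_m -> point n)
    (hA : forall i j : 'I_m, A i = A j -> i = j)
    (c : 'I_m -> R) :
  extreme_ray (C_SAGE A) c ->
  let S := fun p : point n => exists i : 'I_m, c i <> 0 /\ p = A i in
  singleton_set S \/ simplicial_circuit S.
Proof.
move=> cext S; have [k cA] := extreme_SAGE_AGE cext.
have cge (j : 'I_m) : j != k -> (0 <= c j)%R.
  by move=> /eqP jk; case: cA => _ /(_ j jk) /RleP.
have [ck|ck] := leP (0 : R) (c k); [left|right].
  apply: (extreme_ge0_singleton cext) => i.
  by have [->|/cge] := eqVneq i k.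
have [v vc dv] := extreme_dependency cext cA ck.
have -> : S = subfamily A (fun i => v i != 0%R).
  apply/funext => p; apply/propext; split=> -[i [ci ->]]; exists i; split=> //.
    by rewrite vc; apply/eqP.
  by apply/eqP; rewrite -vc.
exact: simplicial_dependency_simplicial_circuit dv.
Qed.
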